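(* Let $\mathbf{k}$ be a commutative $\mathbb{Q}$-algebra, $\Omega$ a set of operator labels and $Y$ a countably infinite set of variables. For any $\mathbf{k}$-submodule $E \subseteq \mathbf{k}\mathfrak{C}_\Omega(Y)$, a commutative $\Omega$-operated $\mathbf{k}$-algebra is an $E$-algebra if and only if it is a $\mathcal{P}(E)$-algebra, where $\mathcal{P}(E)$ is the polarization of $E$.
   Context: All rings and algebras are associative and unital. An $\Omega$-operated algebra $(A; P_\omega \mid \omega\in\Omega)$ is a $\mathbf{k}$-algebra $A$ with $\mathbf{k}$-linear maps $P_\omega\colon A\to A$ ($\omega\in\Omega$), with no further restriction. Bracket words. Write $M(Z)$ and $C(Z)$ for the free monoid and the free commutative monoid on a set $Z$. Put $\mathfrak{M}_{\Omega,0}(Y)=M(Y)$ and recursively $\mathfrak{M}_{\Omega,n}(Y)=M\big(Y\uplus\biguplus_{\omega\in\Omega}\lfloor \mathfrak{M}_{\Omega,n-1}(Y)\rfloor_\omega\big)$, where $\lfloor S\rfloor_\omega=\{\lfloor u\rfloor_\omega\mid u\in S\}$ is a disjoint copy of $S$; let $\mathfrak{M}_\Omega(Y)=\bigcup_n \mathfrak{M}_{\Omega,n}(Y)$. The commutative bracket words $\mathfrak{C}_\Omega(Y)$ are defined in the same way with $C$ in place of $M$. The linear spans $\mathbf{k}\mathfrak{M}_\Omega(Y)$ and $\mathbf{k}\mathfrak{C}_\Omega(Y)$, with operators $u\mapsto\lfloor u\rfloor_\omega$, are the free $\Omega$-operated algebra and the free commutative $\Omega$-operated algebra on $Y$. Let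 $\pi\colon \mathbf{k}\mathfrak{M}_\Omega(Y)\to\mathbf{k}\mathfrak{C}_\Omega(Y)$ be the natural projection (quotient by the operated ideal generated by all $uv-vu$ with $u,v\in\mathfrak{M}_\Omega(Y)$). $E$-algebras. For a map $\theta\colon Y\to A$ into a commutative $\Omega$-operated algebra and $l\in\mathbf{k}\mathfrak{C}_\Omega(Y)$, let $l[\theta]\in A$ be the image of $l$ under the unique homomorphism of $\Omega$-operated algebras extending $\theta$. For a submodule $E\subseteq\mathbf{k}\mathfrak{C}_\Omega(Y)$, $A$ is an $E$-algebra if $l[\theta]=0$ for all $l\in E$ and all $\theta\colon Y\to A$. Polarization, noncommutative case. For a word $u\in\mathfrak{M}_\Omega(Y)$, $\deg_y u$ is the number of occurrences of $y$ in $u$; $l\in\mathbf{k}\mathfrak{M}_\Omega(Y)$ is homogeneous in $y$ of degree $n$ if all its monomials have degree $n$ in $y$. In that case write $l=\sum_i c_i\,q_i[y,\dots,y]$ with $0\ne c_i\in\mathbf{k}$, where $q_i$ is a bracket word on $(Y\setminus\{y\})\cup\{\star_1,\dots,\star_n\}$ containing each placeholder $\star_j$ exactly once, and $q_i[u_1,\dots,u_n]$ denotes replacing $\star_j$ by $u_j$. Put $\mathcal{P}_y(l)=\sum_{\tau\in S_n}\sum_i c_i\,q_i[y_{\tau(1)},\dots,y_{\tau(n)}]$, where $y_1,\dots,y_n\in Y$ are mutually distinct fresh variables (the choice matters only up to renaming). If $l$ is homogeneous in all its variables, $\mathcal{P}(l)$ is obtained by successively polarizing all variables of $l$. For a submodule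 $E'\subseteq\mathbf{k}\mathfrak{M}_\Omega(Y)$, $\mathcal{P}(E')$ is the submodule spanned by the polarizations $\mathcal P(h)$ of all homogeneous components $h$ of elements of $E'$ (components homogeneous in every variable). One assumes, renaming variables if necessary, that infinitely many variables of $Y$ do not occur in the laws considered. Polarization, commutative case. Fix the enumeration order $y_0<y_1<y_2<\cdots$ on $Y$. It is taken as established that every element of $\mathfrak{C}_\Omega(Y)$ can be uniquely written as a bracket word in which all variables of $Y$ appear in increasing order; let $\varrho\colon\mathbf{k}\mathfrak{C}_\Omega(Y)\hookrightarrow\mathbf{k}\mathfrak{M}_\Omega(Y)$ be the resulting embedding of $\mathbf{k}$-modules, sending each commutative bracket word to this increasingly ordered form. If $l\in\mathbf{k}\mathfrak{C}_\Omega(Y)$ is homogeneous in all its variables, its polarization is $\mathcal{P}(l):=\pi(\mathcal{P}(\varrho(l)))$; for a submodule $E\subseteq\mathbf{k}\mathfrak{C}_\Omega(Y)$, its polarization is $\mathcal{P}(E):=\pi(\mathcal{P}(\varrho(E)))$.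
   Formalization: The unique increasing form defining ϱ need not exist (⌊y0 y2⌋y1 has none) or be unique (y0⌊1⌋=⌊1⌋y0), so the theorem is proved for every choice ϱ of representatives that is increasing whenever an increasing form exists. *)

(* Defs.v *)
From HB Require Import structures.
From mathcomp Require Import all_boot all_order all_algebra perm.
From mathcomp Require Import finmap monalg.
From mathcomp Require Import boolp classical_sets.

Set Implicit Arguments.
Unset Strict Implicit.
Unset Printing Implicit Defensive.

Import GRing.Theory.
Local Open Scope ring_scope.
Local Open Scope quotient_scope.
Local Open Scope classical_set_scope.

(* Bracket words on X: lists of letters, a letter being a variable or a       *)
(* bracketed word |_ u _|_w.  The stages M_{Omega,n} of the usual inductive   *)
(* construction are the words of bracket depth at most n.                     *)

Inductive letter (Omega X : Type) : Type :=
| Var of X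
| Br of Omega & seq (letter Omega X).
Arguments Var {Omega X} x.
Arguments Br {Omega X} w u.

Notation bword Omega X := (seq (letter Omega X)).

Section LetterInd.
Context (Omega X : Type) (T : letter Omega X -> Prop).
Hypothesis TVar : forall x, T (Var x).
Hypothesis TBr : forall w u, foldr (fun b Q => T b /\ Q) True u -> T (Br w u).

Fixpoint letter_ind_forall (a : letter Omega X) : T a :=
  match a with
  | Var x => TVar x
  | Br w u => TBr w ((fix all_letters (v : bword Omega X) :
        foldr (fun b Q => T b /\ Q) True v :=
      match v with
      | [::] => I
      | b :: v' => conj (letter_ind_forall b) (all_letters v')
      end) u)
  end.
End LetterInd.

Section LetterChoice.
Context (Omega X : choiceType).

Fixpoint letter_encode (a : letter Omega X) : GenTree.tree (X + Omega) :=
  match a with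
  | Var x => GenTree.Leaf (inl x)
  | Br w u => GenTree.Node 0 (GenTree.Leaf (inr w) :: map letter_encode u)
  end.

Fixpoint letter_decode (t : GenTree.tree (X + Omega)) :
    option (letter Omega X) :=
  match t with
  | GenTree.Leaf (inl x) => Some (Var x)
  | GenTree.Node _ (GenTree.Leaf (inr w) :: ts) =>
      Some (Br w (pmap letter_decode ts))
  | _ => None
  end.

Lemma letter_encodeK : pcancel letter_encode letter_decode.
Proof.
elim/letter_ind_forall => [//|w u ih] /=; congr (Some (Br w _)).
by elim: u ih => //= a u ih [-> /ih ->].
Qed.

HB.instance Definition _ :=
  Choice.copy (letter Omega X) (pcan_type letter_encodeK).
End LetterChoice.

(* Lists of letters up to permutation, the contents of brackets being taken   *)
(* up to the same relation: the classes are the commutative bracket words.    *)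

Inductive word_eqv (Omega X : Type) : bword Omega X -> bword Omega X -> Prop :=
| weqv_nil : word_eqv [::] [::]
| weqv_var x u v : word_eqv u v -> word_eqv (Var x :: u) (Var x :: v)
| weqv_br w u' v' u v :
    word_eqv u' v' -> word_eqv u v -> word_eqv (Br w u' :: u) (Br w v' :: v)
| weqv_swap a b u : word_eqv (a :: b :: u) (b :: a :: u)
| weqv_trans u v t : word_eqv u v -> word_eqv v t -> word_eqv u t.

Section CommutativeWords.
Context (Omega X : choiceType).
Implicit Types (u v t : bword Omega X) (a : letter Omega X).

Lemma word_eqv_refl u : word_eqv u u.
Proof.
have cons_refl a v : word_eqv v v -> word_eqv (a :: v) (a :: v).
  elim/letter_ind_forall: a v => [x|w r ih] v vv; first exact: weqv_var.
  by apply: weqv_br => //; elim: r ih => [_|b r ihr /= [hb /ihr hr]]; [exact: weqv_nil|exact: hb].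
by elim: u => [|a u]; [exact: weqv_nil|exact: cons_refl].
Qed.

Lemma word_eqv_sym u v : word_eqv u v -> word_eqv v u.
Proof.
elim=> {u v} [|x u v _ h|w u' v' u v _ h' _ h|a b u|u v t _ h _ h'].
- exact: weqv_nil.
- exact: weqv_var.
- exact: weqv_br.
- exact: weqv_swap.
- exact: weqv_trans h' h.
Qed.

Lemma word_eqv_cons a u v : word_eqv u v -> word_eqv (a :: u) (a :: v).
Proof.
case: a => [x|w r] h; first exact: weqv_var.
by apply: weqv_br => //; exact: word_eqv_refl.
Qed.

Lemma word_eqv_cat u u' v v' :
  word_eqv u u' -> word_eqv v v' -> word_eqv (u ++ v) (u' ++ v').
Proof.
move=> huu' hvv'; apply: (@weqv_trans _ _ _ (u ++ v')).
  by elim: u {huu'} => // a u; exact: word_eqv_cons.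
elim: huu' => /= {u u'} [|x u u' _ h|w r r' u u' hr _ _ h|a b u|u t u' _ h _ h'].
- exact: word_eqv_refl.
- exact: weqv_var.
- exact: weqv_br.
- exact: weqv_swap.
- exact: weqv_trans h h'.
Qed.

Lemma word_eqv_catC u v : word_eqv (u ++ v) (v ++ u).
Proof.
elim: u v => [|a u ih] v /=; first by rewrite cats0; exact: word_eqv_refl.
apply: weqv_trans (word_eqv_cons a (ih v)) _.
elim: v {ih} => [|b v ih] /=; first exact: word_eqv_refl.
by apply: weqv_trans (weqv_swap _ _ _) _; exact: word_eqv_cons.
Qed.

Lemma word_eqv_size u v : word_eqv u v -> size u = size v.
Proof. by elim=> //= {u v} *; congruence. Qed.

Definition word_eqvb : rel (bword Omega X) := fun u v => `[< word_eqv u v >].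

Lemma word_eqvb_equiv : equiv_class_of word_eqvb.
Proof.
split=> [u|u v|v u t].
- exact/asboolP/word_eqv_refl.
- by apply/asboolP/asboolP; exact: word_eqv_sym.
- by move=> /asboolP huv /asboolP hvt; apply/asboolP/(weqv_trans huv hvt).
Qed.

Canonical word_eqvb_rel := EquivRelPack word_eqvb_equiv.

Definition cword : Type := {eq_quot word_eqvb}.
HB.instance Definition _ := Choice.on cword.
HB.instance Definition _ := EqQuotient.on cword.

Lemma eq_cword u v : word_eqv u v <-> \pi_cword u = \pi_cword v.
Proof.
by split=> [h|/eqmodP/asboolP //]; apply/eqmodP/asboolP.
Qed.

Lemma word_eqv_repr u : word_eqv (repr (\pi_cword u)) u.
Proof. by apply/eq_cword; rewrite reprK. Qed.

Definition cword1 : cword := \pi_cword [::].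
Definition cword_mul (c d : cword) : cword := \pi_cword (repr c ++ repr d).
Definition cword_br (w : Omega) (c : cword) : cword := \pi_cword [:: Br w (repr c)].

Lemma cword_mul_pi u v : cword_mul (\pi u) (\pi v) = \pi_cword (u ++ v).
Proof. by apply/eq_cword/word_eqv_cat; exact: word_eqv_repr. Qed.

Lemma cword_br_pi w u : cword_br w (\pi u) = \pi_cword [:: Br w u].
Proof.
by apply/eq_cword/weqv_br; [exact: word_eqv_repr|exact: weqv_nil].
Qed.

Lemma cword_mulA : associative cword_mul.
Proof.
move=> c d e; rewrite -[c]reprK -[d]reprK -[e]reprK.
by rewrite !cword_mul_pi catA.
Qed.

Lemma cword_mul1m : left_id cword1 cword_mul.
Proof. by move=> c; rewrite -[c]reprK cword_mul_pi. Qed.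

Lemma cword_mulm1 : right_id cword1 cword_mul.
Proof. by move=> c; rewrite -[c]reprK cword_mul_pi cats0. Qed.

Lemma cword_mulC : commutative cword_mul.
Proof.
move=> c d; rewrite -[c]reprK -[d]reprK !cword_mul_pi.
exact/eq_cword/word_eqv_catC.
Qed.

Lemma cword_unitm c d : cword_mul c d = cword1 -> c = cword1 /\ d = cword1.
Proof.
rewrite -[c]reprK -[d]reprK cword_mul_pi => /eq_cword/word_eqv_size.
by case: (repr c) (repr d) => [|? ?] [].
Qed.

HB.instance Definition _ := Choice_isMonomialDef.Build cword
  cword_mulA cword_mul1m cword_mulm1 cword_unitm.
HB.instance Definition _ := MonomialDef_isConomialDef.Build cword cword_mulC.
End CommutativeWords.

Section LinearExtension.
Context (k : comNzRingType) (K : choiceType) (V : lmodType k).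

Definition linext (f : K -> V) (l : {malg k[K]}) : V :=
  \sum_(u <- msupp l) l@_u *: f u.

Lemma linext_is_linear f : linear (linext f).
Proof.
have ext (D : {fset K}) (l : {malg k[K]}) : (msupp l `<=` D)%fset ->
    linext f l = \sum_(u <- D) l@_u *: f u.
  move=> le; rewrite /linext (big_fset_incl _ le) // => x _ /mcoeff_outdom ->.
  by rewrite scale0r.
move=> c l m; pose D := (msupp l `|` msupp m)%fset.
rewrite (ext D l) ?fsubsetUl // (ext D m) ?fsubsetUr //.
rewrite (ext D); last first.
  apply: fsubset_trans (msuppD_le _ _) _; apply: fsetSU; exact: msuppZ_le.
rewrite scaler_sumr -big_split; apply: eq_bigr => u _ /=.
by rewrite mcoeffD mcoeffZ scalerDl scalerA.
Qed.

HB.instance Definition _ f :=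
  GRing.isLinear.Build k {malg k[K]} V *:%R (linext f) (linext_is_linear f).

Lemma linextU f u : linext f << u >> = f u.
Proof. by rewrite /linext msuppU oner_eq0 big_seq_fset1 mcoeffUU scale1r. Qed.

Lemma linear_malg_eq (g h : {malg k[K]} -> V) : linear g -> linear h ->
  (forall u, g << u >> = h << u >>) -> g =1 h.
Proof.
move=> lg lh gh l.
pose gM := GRing.isLinear.Build _ _ _ _ g lg.
pose hM := GRing.isLinear.Build _ _ _ _ h lh.
pose gL : {linear _ -> _} := HB.pack g gM.
pose hL : {linear _ -> _} := HB.pack h hM.
rewrite -[g]/(gL : _ -> _) -[h]/(hL : _ -> _) (monalgE l) !linear_sum.
apply: eq_bigr => c _; rewrite -[l@_c]mulr1.
have -> : << l@_c * 1 *g c >> = l@_c *: << c >> :> {malg k[K]}.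
  by apply/malgP => d; rewrite mcoeffZ !mcoeffU mulrnAr.
by rewrite !linearZ /= gh.
Qed.
End LinearExtension.

(* {malg k[cword Omega Y]}, with its algebra structure from monalg and the    *)
(* operators cbracket w, is the free commutative Omega-operated algebra;      *)
(* {malg k[bword Omega Y]} is only used as a k-module.                        *)

Definition cbracket (k : comNzRingType) (Omega Y : choiceType) (w : Omega) :
    {malg k[cword Omega Y]} -> {malg k[cword Omega Y]} :=
  linext (fun c : cword Omega Y => << cword_br w c >>).

Definition proj (k : comNzRingType) (Omega Y : choiceType) :
    {malg k[bword Omega Y]} -> {malg k[cword Omega Y]} :=
  linext (fun u => << \pi_(cword Omega Y) u >>).

Section Evaluation.
Context (k : comNzRingType) (Omega Y : choiceType) (A : comAlgType k).
Context (P : Omega -> {linear A -> A}) (theta : Y -> A).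

Fixpoint leval (a : letter Omega Y) : A :=
  match a with
  | Var y => theta y
  | Br w u => P w (foldr (fun b x => leval b * x) 1 u)
  end.

Definition weval (u : bword Omega Y) : A :=
  foldr (fun b x => leval b * x) 1 u.

Lemma weval_cat u v : weval (u ++ v) = weval u * weval v.
Proof. by elim: u => [|a u /= ->]; rewrite ?mul1r ?mulrA. Qed.

Lemma weval_eqv u v : word_eqv u v -> weval u = weval v.
Proof.
rewrite /weval; elim=> {u v} //=.
- by move=> x u v _ ->.
- by move=> w u' v' u v _ -> _ ->.
- by move=> a b u; rewrite !mulrA [leval a * _]mulrC.
- by move=> u v t _ -> _ ->.
Qed.

Definition ceval (l : {malg k[cword Omega Y]}) : A :=
  linext (fun c : cword Omega Y => weval (repr c)) l.

Lemma ceval_pi u : ceval << \pi_(cword Omega Y) u >> = weval u.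
Proof. by rewrite /ceval linextU; apply/weval_eqv/word_eqv_repr. Qed.

(* The universal property of the free commutative operated algebra, which     *)
(* defines l[theta].                                                          *)
Lemma ceval_universal (f : {malg k[cword Omega Y]} -> A) :
  [/\ linear f, {morph f : x y / x * y}, f 1 = 1,
      forall w x, f (cbracket w x) = P w (f x) &
      forall y, f << \pi_(cword Omega Y) [:: Var y] >> = theta y] <->
  f = ceval.
Proof.
pose pi u : {malg k[cword Omega Y]} := << \pi_(cword Omega Y) u >>.
have pi_eq (g h : {malg k[cword Omega Y]} -> A) : linear g -> linear h ->
    (forall u, g (pi u) = h (pi u)) -> g =1 h.
  by move=> lg lh gh; apply: linear_malg_eq => // c; rewrite -[c]reprK gh.
have piM u v : pi u * pi v = pi (u ++ v).
  by rewrite malgM_def fgmulUU mulr1; congr << _ >>; exact: cword_mul_pi.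
have piB w u : cbracket w (pi u) = pi [:: Br w u].
  by rewrite /cbracket linextU cword_br_pi.
have cevalL : linear ceval by exact: linext_is_linear.
split=> [[fL fM f1 fP fv]|->].
  apply/funext/pi_eq => // u; rewrite ceval_pi.
  have fl a : f (pi [:: a]) = leval a.
    elim/letter_ind_forall: a => [y|w v ih]; first exact: fv.
    rewrite -piB fP [RHS]/=; congr (P w _).
    elim: v ih => [_|b v ih]; first exact: f1.
    by rewrite [RHS]/= => -[<- /ih <-]; rewrite -fM piM.
  rewrite /weval; elim: u => [|a u ih]; first exact: f1.
  by rewrite [RHS]/= -ih -fl -fM piM.
split=> //.
- have mulM x u : ceval (x * pi u) = ceval x * ceval (pi u).
    move: x; apply: (pi_eq (fun x => _) (fun x => _)) => [c x z|c x z|v].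
    + by rewrite mulrDl -scalerAl cevalL.
    + by rewrite cevalL mulrDl -scalerAl.
    by rewrite piM !ceval_pi weval_cat.
  move=> x; apply: (pi_eq (fun y => _) (fun y => _)) => [c y z|c y z|v].
  + by rewrite mulrDr -scalerAr cevalL.
  + by rewrite cevalL mulrDr -scalerAr.
  exact: mulM.
- exact: (ceval_pi [::]).
- move=> w; apply: (pi_eq (fun x => _) (fun x => _)) => [c x y|c x y|u].
  + by rewrite /cbracket linearP cevalL.
  + by rewrite cevalL linearP.
  by rewrite piB !ceval_pi /weval /= mulr1.
- by move=> y; rewrite ceval_pi /weval /= mulr1.
Qed.
End Evaluation.

Definition is_Ealgebra (k : comNzRingType) (Omega Y : choiceType)
    (A : comAlgType k) (P : Omega -> {linear A -> A})
    (E : set {malg k[cword Omega Y]}) : Prop :=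
  forall l, E l -> forall theta : Y -> A, ceval P theta l = 0.

Section Words.
Context (Omega : Type).

Fixpoint lmap (X X' : Type) (f : X -> X') (a : letter Omega X) :
    letter Omega X' :=
  match a with
  | Var x => Var (f x)
  | Br w u => Br w (map (lmap f) u)
  end.

(* The occurrences of variables, from left to right. *)
Fixpoint lvars (X : Type) (a : letter Omega X) : seq X :=
  match a with
  | Var x => [:: x]
  | Br _ u => flatten (map (@lvars X) u)
  end.

Definition wvars (X : Type) (u : bword Omega X) : seq X :=
  flatten (map (@lvars X) u).

Definition deg (X : eqType) (x : X) (u : bword Omega X) : nat :=
  count_mem x (wvars u).

(* map_from f d j [:: a0; a1; a2] is                                          *)
(* [:: f j a0; f (j + d a0) a1; f (j + d a0 + d a1) a2].                      *)
Fixpoint map_from (L L' : Type) (f : nat -> L -> L') (d : L -> nat) (j : nat)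
    (s : seq L) : seq L' :=
  match s with
  | [::] => [::]
  | a :: s' => f j a :: map_from f d (j + d a)%N s'
  end.

(* mark x u is the word q[*_0, ..., *_(n-1)], n = deg x u, obtained from u by *)
(* replacing the occurrences of x, from left to right, by the placeholders    *)
(* *_j = inr j; and fill x s q is q[s_0, ..., s_(n-1)].  The default value x  *)
(* is not used when s has length n.                                           *)
Fixpoint lmark (X : eqType) (x : X) (j : nat) (a : letter Omega X)
    {struct a} : letter Omega (X + nat) :=
  match a with
  | Var z => Var (if z == x then inr j else inl z)
  | Br w u => Br w (map_from (lmark x) (fun b => count_mem x (lvars b)) j u)
  end.

Definition mark (X : eqType) (x : X) (u : bword Omega X) :
    bword Omega (X + nat) :=
  map_from (lmark x) (fun b => count_mem x (lvars b)) 0%N u.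

Definition fill (X : Type) (x : X) (s : seq X) (q : bword Omega (X + nat)) :
    bword Omega X :=
  map (lmap (fun z => match z with inl y => y | inr j => nth x s j end)) q.

Lemma fill_mark (X : eqType) (x : X) (n : nat) (u : bword Omega X) :
  fill x (nseq n x) (mark x u) = u.
Proof.
rewrite /fill /mark; move: 0%N; elim: u => //= a u ihu j; rewrite ihu.
congr (_ :: _); move: j {ihu}; elim/letter_ind_forall: a => [z|w v ih] j /=.
  by rewrite /=; case: eqP => [->|_] /=; rewrite ?nth_nseq ?if_same.
congr (Br w _); elim: v ih j => //= b v ihv [hb /ihv hv] j.
by rewrite hb hv.
Qed.

(* Each placeholder *_0, ..., *_(n-1) occurs exactly once in mark x u, and x  *)
(* does not occur.                                                            *)
Lemma mark_placeholders (X : eqType) (x : X) (u : bword Omega X) :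
  [seq z <- wvars (mark x u) | if z is inl y then y == x else true] =
  [seq inr j | j <- iota 0%N (deg x u)].
Proof.
pose p (z : X + nat) := if z is inl y then y == x else true.
rewrite /mark /deg /wvars -/p; move: 0%N.
elim: u => //= a u ihu j; rewrite filter_cat ihu count_cat iotaD map_cat.
congr (_ ++ _); move: j {ihu}; elim/letter_ind_forall: a => [z|w v ih] j /=.
  by rewrite /= /p; case: eqVneq => [zx|/negbTE zx] /=; rewrite ?zx ?eqxx.
elim: v ih j => //= b v ihv [hb /ihv hv] j.
by rewrite filter_cat hb hv count_cat iotaD map_cat.
Qed.

End Words.

Section Polarization.
Context (k : comNzRingType) (Omega Y : choiceType).
Implicit Types (l h : {malg k[bword Omega Y]})
  (fresh : {malg k[bword Omega Y]} -> nat -> Y).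

(* A choice, for each l, of infinitely many distinct variables not in l. *)
Definition fresh_choice fresh : Prop :=
  forall l, injective (fresh l) /\
    forall j u, u \in msupp l -> fresh l j \notin wvars u.

Lemma fresh_choice_exists (y_ : nat -> Y) : bijective y_ ->
  exists fresh, fresh_choice fresh.
Proof.
move=> [i_ y_K i_K].
pose bound l := \max_(y <- flatten [seq wvars u | u <- msupp l]) (i_ y).+1.
exists (fun l j => y_ (bound l + j)%N) => l; split=> [i j|j u ul].
  by move/(can_inj y_K)/addnI.
apply/negP => yu.
have : (i_ (y_ (bound l + j)%N) < bound l)%N.
  apply: (@leq_bigmax_seq _ _ xpredT (fun y => (i_ y).+1)) => //.
  by apply/flattenP; exists (wvars u) => //; exact: map_f.
by rewrite y_K ltnNge leq_addr.
Qed.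

(* P_y(l), for l homogeneous in y. *)
Definition polarize_var fresh (y : Y) l : {malg k[bword Omega Y]} :=
  linext (fun u : bword Omega Y => \sum_(t : 'S_(deg y u))
    << fill y [seq fresh l (t i) | i : 'I_(deg y u)] (mark y u) >>) l.

(* P(l), for l homogeneous in all its variables. *)
Definition polarize fresh l : {malg k[bword Omega Y]} :=
  foldl (fun h y => polarize_var fresh y h) l
    (undup (flatten [seq wvars u | u <- msupp l])).

Definition hcomponent (d : Y -> nat) l : {malg k[bword Omega Y]} :=
  \sum_(u <- msupp l | `[< forall y, deg y u = d y >]) << l@_u *g u >>.

Definition span (V : lmodType k) (S : set V) : set V :=
  smallest (fun F : set V => submod_closed [in F]) S.

Definition polarization fresh (E : set {malg k[bword Omega Y]}) :
    set {malg k[bword Omega Y]} :=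
  span [set p | exists2 l, E l & exists d, p = polarize fresh (hcomponent d l)].

(* Commutative bracket words need not have a representative in which all the  *)
(* variables are in increasing order (with y_0 < y_1 < y_2, consider          *)
(* |_ y_0 y_2 _| y_1), nor a unique one (consider y_0 |_ 1 _| and             *)
(* |_ 1 _| y_0).  An ordered form is therefore any choice of representatives  *)
(* which are in increasing order whenever this is possible.                   *)
Definition increasing (y_ : nat -> Y) (u : bword Omega Y) : Prop :=
  exists2 s : seq nat, sorted leq s & wvars u = map y_ s.

Definition ordered_form (y_ : nat -> Y) (rho : cword Omega Y -> bword Omega Y) :
    Prop :=
  forall c, \pi_(cword Omega Y) (rho c) = c /\
    ((exists2 u, \pi_(cword Omega Y) u = c & increasing y_ u) -> increasing y_ (rho c)).

Lemma ordered_form_exists (y_ : nat -> Y) : exists rho, ordered_form y_ rho.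
Proof.
suff /choice[rho rhoP] : forall c, exists r, \pi_(cword Omega Y) r = c /\
    ((exists2 u, \pi_(cword Omega Y) u = c & increasing y_ u) ->
     increasing y_ r) by exists rho.
move=> c; have [[u uc incu]|no] := pselect
  (exists2 u, \pi_(cword Omega Y) u = c & increasing y_ u); first by exists u.
by exists (repr c); rewrite reprK.
Qed.

Definition order_embed (rho : cword Omega Y -> bword Omega Y) :
    {malg k[cword Omega Y]} -> {malg k[bword Omega Y]} :=
  linext (fun c : cword Omega Y => << rho c >>).

Definition cpolarization rho fresh (E : set {malg k[cword Omega Y]}) :
    set {malg k[cword Omega Y]} :=
  @proj k Omega Y @` polarization fresh (order_embed rho @` E).

End Polarization.

(* Main.v *)
Require Import Defs.
From mathcomp Require Import all_boot all_order all_algebra perm.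
From mathcomp Require Import finmap monalg.
From mathcomp Require Import boolp classical_sets.

(** Since the chosen representatives [rho] give a section of the projection to
commutative words, and evaluation in a commutative algebra does not see the
order of the letters, everything takes place among laws [l] on ordinary bracket
words: [A] satisfies [l] if [l] vanishes under all assignments of the variables.
Two facts are needed, and both rest on the absence of torsion in a module over
the rationals.

A law holds if and only if all its multihomogeneous components hold
([law_hcomponent]).  Multiplying the value of a variable [y] by [m] multiplies
the value of a word by [m] to the power of its degree in [y], so a law yields a
polynomial in [m] with values in [A] that vanishes at all natural numbers; its
coefficients, the components, are then zero ([component_eq0]).

Polarizing one variable [y] does not change whether a law [h] holds
([law_polarize_var]), whatever the degrees of the words of [h].
- If [h] holds, its component of degree [n] in [y] vanishes whenever the [n]
  occurrences of [y] receive the same value.  As a function of the values of the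
  occurrences it is additive in each of them, and such a function has zero
  symmetrization as soon as it vanishes on the diagonal ([polarization_eq0]).
- If the polarization holds, give to every fresh variable the value of [y]
  times [m].  A word of degree [n] in [y] then contributes its value times
  [m ^ n * n`!], so each component of [h] in [y] vanishes, up to a factorial.

As the second fact holds for every law, it applies in turn to each intermediate
law of a successive polarization ([law_polarize]). *)

Set Implicit Arguments.
Unset Strict Implicit.
Unset Printing Implicit Defensive.

Import GRing.Theory.
Local Open Scope ring_scope.

(** * Polynomial identities without torsion *)

Section TorsionFree.
Context (V : zmodType).
Hypothesis torsion_free : forall (x : V) n, (0 < n)%N -> x *+ n = 0 -> x = 0.

(** In place of a Vandermonde determinant: [2 ^ N] times the value at [m] minus
the value at [2 * m] has no term of degree [N], and multiplies the other
coefficients by nonzero integers, so induction on the degree applies. *)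
Lemma coefs_eq0_of_values_eq0 N (f : nat -> V) :
  (forall m, \sum_(i < N) f i *+ m ^ i = 0) -> forall i, (i < N)%N -> f i = 0.
Proof.
elim: N f => // N ih f f0.
have ltN i : (i < N)%N -> f i = 0.
  move=> iN; apply: (@torsion_free _ (2 ^ N - 2 ^ i)).
    by rewrite subn_gt0 ltn_exp2l.
  apply: (ih (fun i => f i *+ (2 ^ N - 2 ^ i))) iN => m.
  have := f0 (2 * m)%N; rewrite big_ord_recr /= => /eqP.
  rewrite expnMn addr_eq0 => /eqP e.
  have := congr1 (fun x => x *+ 2 ^ N) (f0 m).
  rewrite big_ord_recr /= mul0rn mulrnDl => /eqP.
  rewrite -mulrnA mulnC addr_eq0 -e -sumrMnl => /eqP {}e.
  apply/eqP; rewrite -[X in _ == X](subrr (\sum_(i < N) f i *+ (2 * m) ^ i)).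
  rewrite -{1}e -sumrB; apply/eqP/eq_bigr => j _.
  rewrite -mulrnA mulnBl mulrnBr;
    last by rewrite leq_mul2r leq_exp2l // (ltnW (ltn_ord j)) orbT.
  by rewrite -mulrnA expnMn [(m ^ j * _)%N]mulnC.
move=> i; rewrite ltnS leq_eqVlt => /predU1P[->|/ltN//].
have := f0 1%N; rewrite big_ord_recr /= exp1n mulr1n.
by rewrite big1 ?add0r // => j _; rewrite ltN ?mul0rn.
Qed.

Lemma component_eq0 (T : eqType) (r : seq T) (p : pred T) (F : T -> V)
    (d : T -> nat) :
  (forall m, \sum_(u <- r | p u) F u *+ m ^ d u = 0) ->
  forall n, \sum_(u <- r | p u && (d u == n)) F u = 0.
Proof.
move=> F0 n; pose N := (\max_(u <- r) d u).+1.
have dN u : u \in r -> (d u < N)%N.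
  by move=> ur; rewrite ltnS; exact: leq_bigmax_seq.
pose f i := \sum_(u <- r | p u && (d u == i)) F u.
have [nN|Nn] := ltnP n N; last first.
  rewrite big_seq_cond big1 // => u /and3P[/dN + _ /eqP du].
  by rewrite du ltnNge Nn.
apply: (@coefs_eq0_of_values_eq0 N f) nN => m; rewrite -[RHS](F0 m).
rewrite [RHS]big_seq_cond.
rewrite (partition_big (fun u => inord (d u) : 'I_N) predT) //=.
apply: eq_bigr => i _; rewrite /f -sumrMnl [LHS]big_seq_cond.
apply: congr_big => // [u|u /and3P[_ _ /eqP->]//].
rewrite -andbA; case ur: (u \in r) => //=; congr (_ && _).
by rewrite -val_eqE /= inordK // dN.
Qed.

End TorsionFree.

Lemma sum_eq0_of_fibers (V : zmodType) (T D : eqType) (r : seq T) (F : T -> V)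
    (key : T -> D) :
  (forall x, \sum_(u <- r | key u == x) F u = 0) -> \sum_(u <- r) F u = 0.
Proof.
move=> F0; elim: {r}(size r).+1 {-2}r (ltnSn (size r)) F0 => // n ih r.
case: r => [|u r rn] F0; first by rewrite big_nil.
rewrite (bigID (fun v => key v == key u)) /= F0 add0r -big_filter; apply: ih.
  rewrite /= eqxx /= size_filter (leq_ltn_trans (count_size _ _)) //.
move=> x; rewrite big_filter_cond; have [->|xu] := eqVneq x (key u).
  by rewrite big1 // => v /andP[/negbTE->].
rewrite -[RHS](F0 x); apply: eq_bigl => v.
by case: (eqVneq (key v) x) => [->|]; rewrite ?andbF ?xu.
Qed.

(** * Symmetrization of multiadditive functions *)

Lemma sum_tuple_cons (V : zmodType) (I : finType) n (p : pred I)
    (F : seq I -> V) :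
  \sum_(s : n.+1.-tuple I | all p s) F s =
  \sum_(i | p i) \sum_(s : n.-tuple I | all p s) F (i :: s).
Proof.
rewrite pair_big /= (reindex (fun x : I * n.-tuple I => cons_tuple x.1 x.2)) //.
exists (fun s : n.+1.-tuple I => (thead s, [tuple of behead s])).
  move=> [i s] _ /=.
  by congr (_, _); apply: val_inj.
by move=> s _; rewrite [RHS]tuple_eta; apply: val_inj.
Qed.

Section Multiadditive.
Context (V W : zmodType).

(** A function of [n] variables is encoded on lists, with its values constrained
on lists of size [n] only, so that fixing the first argument is consing. *)
Definition multiadditive n (G : seq V -> W) := forall p q x y,
  (size p + size q).+1 = n ->
  G (p ++ (x + y) :: q) = G (p ++ x :: q) + G (p ++ y :: q).

Lemma multiadditive_expand (I : finType) n G (p : pred I) (a : I -> V) :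
  multiadditive n G ->
  G (nseq n (\sum_(i | p i) a i)) =
  \sum_(s : n.-tuple I | all p s) G (map a s).
Proof.
elim: n G => [|n ih] G addG.
  rewrite (big_pred1 [tuple]) // => s.
  by rewrite [s]tuple0; apply/esym/eqP.
rewrite (@sum_tuple_cons _ I _ _ (fun s => G (map a s))) /=.
set v := \sum_(i | _) _.
have addG1 x y : G (x + y :: nseq n v) = G (x :: nseq n v) + G (y :: nseq n v).
  by apply: (addG [::]); rewrite size_nseq.
have G0 : G (0 :: nseq n v) = 0.
  by apply: (addrI (G (0 :: nseq n v))); rewrite -addG1 !addr0.
rewrite {1}/v (big_morph (fun x => G (x :: nseq n v)) addG1 G0).
apply: eq_bigr => i _; apply: (ih (fun s => G (a i :: s))) => q r x y e.
by apply: (addG (a i :: q)); rewrite /= addSn e.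
Qed.

(** Vanishing on the diagonal, expanded at the sum of the [a i] for [i] in [p],
says that the terms [G (a i_1, .., a i_n)] with all indices in [p] add up to
zero.  Subtracting the same statement for [p] minus [i] leaves the terms in
which [i] occurs; doing so for all [i] leaves the terms indexed by
permutations. *)
Lemma polarization_eq0 n (G : seq V -> W) : multiadditive n G ->
  (forall v, G (nseq n v) = 0) ->
  forall a : 'I_n -> V, \sum_(t : 'S_n) G [seq a (t i) | i : 'I_n] = 0.
Proof.
move=> addG G0 a.
have onto (r : seq 'I_n) (p : pred 'I_n) :
    \sum_(s : n.-tuple 'I_n | all p s && all (mem s) r) G (map a s) = 0.
  elim: r p => [|i r ih] p.
    under eq_bigl do rewrite andbT.
    by rewrite -multiadditive_expand.
  have := ih p; rewrite (bigID (fun s : n.-tuple 'I_n => i \in s)) /=.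
  rewrite [X in _ + X = _](eq_bigl (fun s : n.-tuple 'I_n =>
    all [pred j | p j & j != i] s && all (mem s) r)) => [|s]; last first.
    rewrite andbAC; congr (_ && _); rewrite all_predI; congr (_ && _).
    by rewrite -has_pred1 -all_predC.
  rewrite ih addr0 => s0; rewrite -[RHS]s0; apply: eq_bigl => s /=.
  by rewrite -andbA [(i \in s) && _]andbC.
rewrite -[RHS](onto (enum 'I_n) predT).
(* A list of n indices which contains all of them is a permutation. *)
rewrite [RHS](reindex (fun t : 'S_n => [tuple t i | i < n])) /=; last first.
  exists (fun s : n.-tuple 'I_n => insubd (1%g : 'S_n) [ffun i => tnth s i]).
    move=> t _; apply: val_inj; rewrite val_insubd.
    have -> : [ffun i => tnth [tuple t i | i < n] i] = val t.
      by apply/ffunP => i; rewrite ffunE tnth_mktuple -pvalE.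
    by rewrite (valP t).
  move=> s /andP[_ /allP sT]; apply: eq_from_tnth => i; rewrite tnth_mktuple.
  rewrite -pvalE val_insubd ifT ?ffunE //; apply/injectiveP => j l.
  rewrite !ffunE; have /uniqP us : uniq s.
    apply: leq_size_uniq (enum_uniq 'I_n) sT _.
    by rewrite size_tuple size_enum_ord.
  rewrite !(tnth_nth j) => /us; rewrite !inE size_tuple.
  move=> /(_ (ltn_ord _) (ltn_ord _)); exact: val_inj.
apply: eq_big => [t|t _].
  rewrite all_predT; apply/esym/allP => i _.
  by apply/mapP; exists (t^-1 i)%g; rewrite ?mem_enum ?permKV.
by congr G; rewrite /= -map_comp.
Qed.
End Multiadditive.

(** * Evaluation of bracket words *)

Section Words.
Context (k : comNzRingType) (Omega : choiceType) (A : comAlgType k).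
Context (P : Omega -> {linear A -> A}).

Definition assign (X : eqType) (theta : X -> A) (x : X) (v : A) : X -> A :=
  fun z => if z == x then v else theta z.

Lemma weval_cons (X : choiceType) (theta : X -> A) a (u : bword Omega X) :
  weval P theta (a :: u) = leval P theta a * weval P theta u.
Proof. by []. Qed.

Lemma wvars_cons (X : eqType) a (u : bword Omega X) :
  wvars (a :: u) = lvars a ++ wvars u.
Proof. by []. Qed.

Lemma leval_Br (X : choiceType) (theta : X -> A) w (u : bword Omega X) :
  leval P theta (Br w u) = P w (weval P theta u).
Proof. by []. Qed.

Lemma eq_in_weval (X : choiceType) (theta theta' : X -> A) (u : bword Omega X) :
  {in wvars u, theta =1 theta'} -> weval P theta u = weval P theta' u.
Proof.
have step a v :
    ({in lvars a, theta =1 theta'} -> leval P theta a = leval P theta' a) ->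
    ({in wvars v, theta =1 theta'} -> weval P theta v = weval P theta' v) ->
    {in wvars (a :: v), theta =1 theta'} ->
    weval P theta (a :: v) = weval P theta' (a :: v).
  rewrite wvars_cons !weval_cons => ha hv e.
  by rewrite ha ?hv // => x xs; apply: e; rewrite mem_cat xs ?orbT.
elim: u => // a u; apply: (step); elim/letter_ind_forall: a => [x e|w v ih].
  by apply: e; rewrite inE.
rewrite !leval_Br => e; congr (P w _); move: e.
elim: v ih => // a v ihv [ha /ihv]; exact: step ha.
Qed.

Lemma weval_map (X X' : choiceType) (theta : X' -> A) (f : X -> X')
    (u : bword Omega X) :
  weval P theta (map (lmap f) u) = weval P (theta \o f) u.
Proof.
elim: u => // a u ihu; rewrite map_cons !weval_cons ihu; congr (_ * _).
elim/letter_ind_forall: a {ihu} => // w v ih.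
rewrite [lmap _ _]/= !leval_Br; congr (P w _).
by elim: v ih => // a v ihv [ha /ihv hv]; rewrite map_cons !weval_cons ha hv.
Qed.

Lemma weval_scale (X : choiceType) (theta : X -> A) (x : X) m
    (u : bword Omega X) :
  weval P (assign theta x (theta x *+ m)) u = weval P theta u *+ m ^ deg x u.
Proof.
rewrite /deg; set theta' := assign _ _ _.
have step a v :
    leval P theta' a = leval P theta a *+ m ^ count_mem x (lvars a) ->
    weval P theta' v = weval P theta v *+ m ^ count_mem x (wvars v) ->
    weval P theta' (a :: v) =
    weval P theta (a :: v) *+ m ^ count_mem x (wvars (a :: v)).
  rewrite wvars_cons !weval_cons => -> ->.
  by rewrite count_cat expnD mulrnAl mulrnAr -mulrnA mulnC.
elim: u => // a u; apply: (step); elim/letter_ind_forall: a => [z|w v ih].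
  by rewrite /= addn0 /theta' /assign; case: eqP => [->|].
rewrite !leval_Br -raddfMn; congr (P w _).
elim: v ih => // a v ihv [ha /ihv]; exact: step ha.
Qed.

(** Nested operators do no harm: along the path from the root of the word to the
single occurrence of [x], one only multiplies by factors not containing [x] and
applies additive maps. *)
Lemma weval_additive (X : choiceType) (theta : X -> A) (x : X) v1 v2
    (u : bword Omega X) : deg x u = 1%N ->
  weval P (assign theta x (v1 + v2)) u =
  weval P (assign theta x v1) u + weval P (assign theta x v2) u.
Proof.
pose ev v := weval P (assign theta x v).
pose lev v := leval P (assign theta x v).
rewrite /deg -!/(ev _).
have const v v' t : count_mem x (wvars t) = 0%N -> ev v t = ev v' t.
  move=> /eqP; rewrite -leqn0 leqNgt -has_count has_pred1 => xt.
  apply: eq_in_weval => z zt; rewrite /assign ifN ?ifN //.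
    by apply: contraNneq xt => <-.
  by apply: contraNneq xt => <-.
have step a t :
    (count_mem x (lvars a) = 1%N -> lev (v1 + v2) a = lev v1 a + lev v2 a) ->
    (count_mem x (wvars t) = 1%N -> ev (v1 + v2) t = ev v1 t + ev v2 t) ->
    count_mem x (wvars (a :: t)) = 1%N ->
    ev (v1 + v2) (a :: t) = ev v1 (a :: t) + ev v2 (a :: t).
  rewrite wvars_cons /ev !weval_cons -!/(ev _ _) -!/(lev _ _) count_cat.
  move=> ha ht.
  case da: (count_mem x (lvars a)) ha => [|[|//]] ha dt.
    have e v v' : lev v a = lev v' a.
      have := const v v' [:: a]; rewrite /ev !weval_cons /weval /= !mulr1.
      by rewrite wvars_cons cats0 da; exact.
    by rewrite ht // (e (v1 + v2) v1) (e v2 v1) mulrDr.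
  move: dt => [dt]; rewrite ha // (const v2 v1 t dt) (const (v1 + v2) v1 t dt).
  by rewrite mulrDl.
elim: u => // a u; apply: (step); elim/letter_ind_forall: a => [z|w v ih].
  by rewrite /lev /= addn0 /assign; case: eqP.
rewrite /lev !leval_Br -raddfD => e; congr (P w _); move: e.
elim: v ih => // a v ihv [ha /ihv]; exact: step ha.
Qed.

(** The value of a word with placeholders as a function of the values of the
placeholders, those of the other variables being fixed. *)
Definition slots (X : eqType) (theta : X -> A) (s : nat -> A) : X + nat -> A :=
  fun z => match z with inl x => theta x | inr j => s j end.

Lemma weval_fill (X : choiceType) (theta : X -> A) (y : X) s
    (q : bword Omega (X + nat)) :
  weval P theta (fill y s q) =
  weval P (slots theta (fun j => theta (nth y s j))) q.
Proof.
by rewrite /fill weval_map; congr (weval P _ q); apply/funext => -[].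
Qed.

Lemma slot_lt_deg (X : eqType) (y : X) (u : bword Omega X) j :
  inr j \in wvars (mark y u) -> (j < deg y u)%N.
Proof.
move=> ju; suff : inr j \in [seq (inr i : X + nat) | i <- iota 0 (deg y u)].
  by case/mapP => i; rewrite mem_iota add0n => + [->].
by rewrite -mark_placeholders mem_filter.
Qed.

Lemma slot_once (X : eqType) (y : X) (u : bword Omega X) j :
  (j < deg y u)%N -> deg (inr j) (mark y u) = 1%N.
Proof.
move=> jd; have <- : count_mem (inr j)
    [seq z <- wvars (mark y u) | if z is inl x then x == y else true] = 1%N.
  rewrite mark_placeholders count_uniq_mem ?map_inj_uniq ?iota_uniq //.
    by rewrite mem_map ?mem_iota ?add0n ?jd // => i i' [].
  by move=> i i' [].
rewrite count_filter; apply: eq_count => z /=.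
by case: eqP => [->|].
Qed.

Lemma marked_notin (X : eqType) (y : X) (u : bword Omega X) :
  inl y \notin wvars (mark y u).
Proof.
apply/negP => yu.
suff : inl y \in [seq (inr i : X + nat) | i <- iota 0 (deg y u)].
  by case/mapP.
by rewrite -mark_placeholders mem_filter eqxx.
Qed.

Lemma weval_mark (X : choiceType) (theta : X -> A) (y : X) v (u : bword Omega X)
    (s : nat -> A) : (forall j, (j < deg y u)%N -> s j = v) ->
  weval P (slots theta s) (mark y u) = weval P (assign theta y v) u.
Proof.
move=> sv; rewrite -[in RHS](fill_mark y (deg y u) u) weval_fill.
apply: eq_in_weval => -[x|j] xu /=.
  by rewrite /assign ifN //; apply: contraTneq xu => ->; exact: marked_notin.
by rewrite sv ?slot_lt_deg // nth_nseq if_same /assign eqxx.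
Qed.

(** Each placeholder occurs exactly once, so [weval_additive] applies to it. *)
Lemma weval_mark_multiadditive (X : choiceType) (theta : X -> A) (y : X)
    (u : bword Omega X) :
  multiadditive (deg y u)
    (fun s => weval P (slots theta (nth 0 s)) (mark y u)).
Proof.
move=> p q v1 v2 e.
have slotE v : slots theta (nth 0 (p ++ v :: q)) =
    assign (slots theta (nth 0 (p ++ 0 :: q))) (inr (size p)) v.
  apply/funext => -[x|j]; rewrite /assign //=.
  rewrite !nth_cat; case: ltngtP => jp.
  - by case: eqP => // -[jp']; move: jp; rewrite jp' ltnn.
  - case: eqP => [[jp']|_]; first by move: jp; rewrite jp' ltnn.
    by rewrite -[(j - _)%N]prednK ?subn_gt0.
  - by rewrite jp subnn /= eqxx.
rewrite (slotE (v1 + v2)) (slotE v1) (slotE v2).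
by rewrite weval_additive // slot_once // -e ltnS leq_addr.
Qed.

End Words.

(** * Laws and their polarizations *)

Section Laws.
Context (k : comAlgType rat) (Omega Y : choiceType) (A : comAlgType k).
Context (P : Omega -> {linear A -> A}).
Implicit Types (l h : {malg k[bword Omega Y]}).

Lemma rat_torsion_free (x : A) n : (0 < n)%N -> x *+ n = 0 -> x = 0.
Proof.
move=> n0 xn; have := congr1 ( *:%R ((n%:R^-1 : rat)%:A : k)) xn.
rewrite scaler0 -scaler_nat scalerA -scaler_nat -scalerAl mul1r scalerA.
by rewrite mulVf ?Num.Theory.pnatr_eq0 -?lt0n // scale1r scale1r.
Qed.

Lemma nth_image_ord (T : Type) (x0 : T) n (f : 'I_n -> T) j (jn : (j < n)%N) :
  nth x0 [seq f i | i : 'I_n] j = f (Ordinal jn).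
Proof.
rewrite (nth_map (Ordinal jn)) ?size_enum_ord //.
by congr f; apply: val_inj; exact: nth_enum_ord.
Qed.

Definition law l := forall theta : Y -> A, linext (weval P theta) l = 0.

Lemma linear_linext (K : choiceType) (V W : lmodType k) (g : {linear V -> W})
    (f : K -> V) (l : {malg k[K]}) : g (linext f l) = linext (g \o f) l.
Proof. by rewrite linear_sum; apply: eq_bigr => u _; rewrite linearZ. Qed.

Lemma ceval_proj (theta : Y -> A) l :
  ceval P theta (proj l) = linext (weval P theta) l.
Proof.
rewrite /ceval /proj linear_linext; congr linext; apply/funext => u.
exact: ceval_pi.
Qed.

Lemma proj_order_embed (rho : cword Omega Y -> bword Omega Y) :
  (forall c, (\pi_(cword Omega Y) (rho c))%qT = c) ->
  cancel (@order_embed k Omega Y rho) (@proj k Omega Y).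
Proof.
move=> rhoK l; rewrite /proj /order_embed linear_linext; move: l.
apply: (linear_malg_eq (h := id)) => [||c]; [exact: linearP|by []|].
by rewrite linextU /= linextU rhoK.
Qed.

Lemma law_component l (p : pred (bword Omega Y)) (y : Y) n :
  (forall theta, \sum_(u <- msupp l | p u) l@_u *: weval P theta u = 0) ->
  forall theta,
  \sum_(u <- msupp l | p u && (deg y u == n)) l@_u *: weval P theta u = 0.
Proof.
move=> l0 theta; apply: component_eq0 => [|m]; first exact: rat_torsion_free.
rewrite -[RHS](l0 (assign theta y (theta y *+ m))); apply: eq_bigr => u _.
by rewrite weval_scale scalerMnr.
Qed.

Lemma linext_polarize_var fresh (y : Y) h (theta : Y -> A) :
  linext (weval P theta) (polarize_var fresh y h) =
  \sum_(u <- msupp h) h@_u *: \sum_(t : 'S_(deg y u))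
    weval P (slots theta (nth 0 [seq theta (fresh h (t i)) | i : 'I_(deg y u)]))
      (mark y u).
Proof.
rewrite /polarize_var linear_linext; apply: eq_bigr => u _ /=.
congr (_ *: _); rewrite linear_sum; apply: eq_bigr => t _.
rewrite /= linextU weval_fill.
apply: eq_in_weval => -[//|j] /slot_lt_deg ju /=.
by rewrite !nth_image_ord.
Qed.

(** Freshness enters in the implication from left to right: the words of [h] keep
their values when the fresh variables are reassigned. *)
Lemma law_polarize_var fresh (y : Y) h :
  fresh_choice fresh -> law (polarize_var fresh y h) <-> law h.
Proof.
move=> fresh_ok; have [_ fresh_notin] := fresh_ok h; split=> hlaw theta.
  pose theta' m z :=
    if `[< exists j, z = fresh h j >] then theta y *+ m else theta z.
  have theta'_fresh m j : theta' m (fresh h j) = theta y *+ m.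
    by rewrite /theta' ifT //; apply/asboolP; exists j.
  (* n occurrences of y contribute m ^ n, and the n`! permutations contribute
     the same value. *)
  have step m : \sum_(u <- msupp h)
      (h@_u *: weval P theta u *+ (deg y u)`!) *+ m ^ deg y u = 0.
    rewrite -[RHS](hlaw (theta' m)) linext_polarize_var big_seq [RHS]big_seq.
    apply: eq_bigr => u uh; rewrite -mulrnA mulnC mulrnA scalerMnr.
    rewrite -weval_scale scalerMnr; congr (_ *: _).
    rewrite -card_Sn -sumr_const.
    apply: eq_big => [t|t _]; first by rewrite inE.
    rewrite (@weval_mark _ _ _ _ _ _ _ (theta y *+ m)).
      apply: eq_in_weval => z zu; rewrite /assign; case: eqP => // _.
      rewrite /theta' ifN //; apply/asboolP => -[j zj].
      by have := fresh_notin j u uh; rewrite -zj zu.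
    move=> j ju; by rewrite nth_image_ord.
  apply: (sum_eq0_of_fibers (key := deg y)) => n.
  apply: (@rat_torsion_free _ n`!); first exact: fact_gt0.
  rewrite -sumrMnl -[RHS](component_eq0 rat_torsion_free (p := predT) step n).
  by apply: eq_bigr => u /eqP->.
rewrite linext_polarize_var.
apply: (sum_eq0_of_fibers (key := deg y)) => n.
pose G s := \sum_(u <- msupp h | deg y u == n)
  h@_u *: weval P (slots theta (nth 0 s)) (mark y u).
have addG : multiadditive n G.
  move=> p q x1 x2 e; rewrite -big_split; apply: eq_bigr => u /eqP du /=.
  by rewrite -scalerDr weval_mark_multiadditive // du.
have G0 v : G (nseq n v) = 0.
  rewrite -[RHS](law_component (p := predT) y n hlaw (assign theta y v)).
  apply: eq_bigr => u /eqP du.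
  by rewrite (@weval_mark _ _ _ _ _ _ _ v) // => j; rewrite du nth_nseq => ->.
rewrite -[RHS](polarization_eq0 addG G0 (fun i => theta (fresh h i))).
rewrite /G exchange_big /=; apply: eq_bigr => u /eqP <-; exact: scaler_sumr.
Qed.

Lemma law_polarize fresh h :
  fresh_choice fresh -> law (polarize fresh h) <-> law h.
Proof.
move=> fresh_ok; rewrite /polarize; move: (undup _) => ys.
elim: ys h => //= y ys ih h.
by rewrite ih law_polarize_var.
Qed.

Lemma linext_hcomponent (theta : Y -> A) (d : Y -> nat) l :
  linext (weval P theta) (hcomponent d l) =
  \sum_(u <- msupp l | `[< forall y, deg y u = d y >]) l@_u *: weval P theta u.
Proof.
rewrite linear_sum; apply: eq_bigr => u _.
have -> : << l@_u *g u >> = l@_u *: << u >> :> {malg k[bword Omega Y]}.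
  by apply/malgP => v; rewrite mcoeffZ !mcoeffU mulrnAr mulr1.
by rewrite linearZ /= linextU.
Qed.

Lemma law_hcomponent l : (forall d, law (hcomponent d l)) <-> law l.
Proof.
split=> [l0 theta|l0 d theta].
  (* Words are grouped by their multidegree, a function on all variables. *)
  pose key (u : bword Omega Y) : {classic (Y -> nat)} := (fun y : Y => deg y u).
  apply: (sum_eq0_of_fibers (key := key)) => d.
  rewrite -[RHS](l0 d theta) linext_hcomponent; apply: eq_bigl => u.
  by apply/eqP/asboolP => [<-//|du]; apply/funext.
rewrite linext_hcomponent.
pose ys := flatten [seq wvars u | u <- msupp l].
have degE u y : u \in msupp l -> y \notin ys -> deg y u = 0%N.
  move=> ul; apply: contraNeq; rewrite /deg -lt0n -has_count has_pred1 => yu.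
  by apply/flattenP; exists (wvars u) => //; exact: map_f.
(* A multidegree which is nonzero outside the finitely many variables ys of l
   has an empty component; otherwise only the degrees in ys have to be fixed. *)
have [d0|] := pselect (forall y, y \notin ys -> d y = 0%N); last first.
  move=> nd; rewrite big_seq_cond big1 // => u /andP[ul /asboolP du].
  by case: nd => y yys; rewrite -du degE.
have comp zs : forall theta, \sum_(u <- msupp l |
    all (fun y => deg y u == d y) zs) l@_u *: weval P theta u = 0.
  elim: zs => [|z zs ih] {}theta; first exact: l0.
  rewrite -[RHS](law_component z (d z) ih theta).
  by apply: eq_bigl => u; rewrite /= andbC.
rewrite -[RHS](comp ys theta) big_seq_cond [RHS]big_seq_cond.
apply: eq_bigl => u; case ul: (u \in _) => //=.
apply/asboolP/allP => [du y _|du y]; first by rewrite du.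
have [/du/eqP//|yys] := boolP (y \in ys).
by rewrite degE // d0.
Qed.

End Laws.

Theorem corollary2p18 (k : comAlgType rat) (Omega Y : choiceType)
    (y_ : nat -> Y) (y_bij : bijective y_)
    (rho : cword Omega Y -> bword Omega Y) (rho_ordered : ordered_form y_ rho)
    (fresh : {malg k[bword Omega Y]} -> nat -> Y)
    (fresh_ok : fresh_choice fresh)
    (E : set {malg k[cword Omega Y]}) (E_submod : submod_closed [in E])
    (A : comAlgType k) (P : Omega -> {linear A -> A}) :
  is_Ealgebra P E <-> is_Ealgebra P (cpolarization rho fresh E).
Proof.
have embedK := @proj_order_embed k _ _ rho (fun c => (rho_ordered c).1).
split=> [EA _ [p Ep <-] theta|EA l El theta].
  rewrite ceval_proj; move: p Ep theta; apply: (smallest_sub (X := law P)).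
    split=> [|c p q]; rewrite !inE /=; first by move=> theta; exact: linear0.
    by move=> lp lq theta; rewrite linearP /= lp lq scaler0 addr0.
  move=> _ [_ [l El <-] [d ->]]; apply/(law_polarize P) => //; move: d.
  apply/law_hcomponent => theta; rewrite -ceval_proj embedK; exact: EA.
rewrite -(embedK l) ceval_proj; move: theta; apply/law_hcomponent => d.
apply/(law_polarize P _ fresh_ok) => theta; rewrite -ceval_proj; apply: EA.
apply: imageP; apply: sub_gen_smallest.
by exists (order_embed rho l); [exists l|exists d].
Qed.
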